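(* Let $T$ be a regular $n\times n$ holomorphic matrix-valued function on a domain containing the closure of $\mathcal{D}$, with distinct eigenvalues $\lambda_1,\dots,\lambda_s$ in $\mathcal{D}$, let $m_{i,1}$ be the largest partial multiplicity of $\lambda_i$, and let $S_{ik}$ ($1\le i\le s$, $1\le k\le m_{i,1}$) be the coefficient matrices in $$T(z)^{-1}=\sum_{i=1}^s\sum_{k=1}^{m_{i,1}}S_{ik}(z-\lambda_i)^{-k}+H(z),\qquad H\text{ holomorphic in }\mathcal{D}.$$ Assume $S_{ik}\in\mathbb{F}^{n\times n}$. Consider $F(z)=\Omega_L^{\mathsf H}T(z)^{-1}\Omega_R$, where $\Omega_L$ and $\Omega_R$ are two i.i.d. $n\times b$ Gaussian random matrices in $\mathbb{F}$, so that the coefficients of $(z-\lambda_i)^{-k}$ in $F$ are $\Omega_L^{\mathsf H}S_{ik}\Omega_R$. Then, for sufficiently small $\epsilon>0$, $$\mathsf{P}\Biggl(\min_{\substack{1\le i\le s,\ 1\le k\le m_{i,1}\\ S_{ik}\ne0}}\frac{\|\Omega_L^{\mathsf H}S_{ik}\Omega_R\|_{\mathsf F}}{\|S_{ik}\|}\le\epsilon\Biggr)=\mathcal{O}\bigl((\epsilon^{\ell}|\log\epsilon|)^{b}\bigr),$$ where $\ell=1$ for $\mathbb{F}=\mathbb{R}$ and $\ell=2$ for $\mathbb{F}=\mathbb{C}$.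
   Context: $\mathcal{D}\subset\mathbb{C}$ is a nonempty domain enclosed by a Jordan curve. $T$ is regular if $\det T(z_0)\ne0$ for some $z_0\in\mathcal{D}$; $\lambda\in\mathcal{D}$ is an eigenvalue of $T$ if $T(\lambda)$ is singular. The partial multiplicities $m_{i,1}\ge\dots\ge m_{i,d_i}\ge 1$ of $\lambda_i$ ($d_i=\dim\ker T(\lambda_i)$) are the positive exponents in the local Smith form of $T$ at $\lambda_i$, equivalently the Jordan block sizes in Keldysh's representation $T(z)^{-1}=\sum_{i=1}^s\sum_{j=1}^{d_i}V_{L,ij}(zI-J_{ij})^{-1}V_{R,ij}^{\mathsf H}+H(z)$, where $J_{ij}$ is the $m_{ij}\times m_{ij}$ upper Jordan block with eigenvalue $\lambda_i$ and $V_{L,ij},V_{R,ij}\in\mathbb{C}^{n\times m_{ij}}$. Writing $V_{L,ij}=[v_{L,ij}^0,\dots,v_{L,ij}^{m_{ij}-1}]$ and $V_{R,ij}=[v_{R,ij}^{m_{ij}-1},\dots,v_{R,ij}^{0}]$, one has $S_{ik}=\sum_{1\le j\le d_i,\ k\le m_{ij}}\sum_{\ell'=0}^{m_{ij}-k}v_{L,ij}^{\ell'}\bigl(v_{R,ij}^{m_{ij}-k-\ell'}\bigr)^{\mathsf H}$; these are the coefficients of the principal part of $T^{-1}$ at $\lambda_i$. $\mathbb{F}$ is $\mathbb{R}$ or $\mathbb{C}$. A real Gaussian matrix has i.i.d. $\mathcal{N}(0,1)$ entries; a complex Gaussian matrix has entries whose real and imaginary parts are all i.i.d. $\mathcal{N}(0,1/2)$.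 ''$\Omega_L,\Omega_R$ i.i.d.'' means they are independent Gaussian matrices. $\|\cdot\|$ is the spectral norm, $\|\cdot\|_{\mathsf F}$ the Frobenius norm. $a=\mathcal{O}(b)$ means $|a|\le c|b|$ for some positive constant $c$ (independent of $\epsilon$). *)

(* Defs.v *)
From HB Require Import structures.
From mathcomp Require Import all_boot all_order all_algebra.
From mathcomp Require Import complex.
From mathcomp Require Import all_classical all_reals all_analysis.

Set Implicit Arguments.
Unset Strict Implicit.
Unset Printing Implicit Defensive.

Import Order.TTheory GRing.Theory Num.Theory.
Import numFieldNormedType.Exports.

Local Open Scope classical_set_scope.
Local Open Scope ring_scope.
Local Open Scope complex_scope.

(* The complex numbers are [R[i]]; its topology and normed structure are found
   through the regular module [R[i]^o], hence the casts below. *)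

Section holomorphic_matrices.
Context {R : realType}.

Definition jordan_curve (gamma : R -> R[i]^o) : Prop :=
  [/\ {within `[0, 1], continuous gamma},
      gamma 0 = gamma 1 & set_inj `[0, 1[ gamma].

(* The domain enclosed by a Jordan curve is the bounded connected component of
   the complement of the curve.  [connected_component A z] is empty if [z] is
   not in [A]. *)
Definition jordan_domain (D : set R[i]^o) : Prop :=
  D !=set0 /\
  exists2 gamma : R -> R[i]^o, jordan_curve gamma &
    bounded_set D /\
    exists z, D = connected_component (~` (gamma @` `[0, 1])) z.

(* Differentiability in the complex direction [1] is complex
   differentiability. *)
Definition holomorphic_mx_at p q (G : R[i] -> 'M[R[i]]_(p, q)) (z : R[i]) :
    Prop :=
  forall i j, derivable (fun x : R[i]^o => G x i j : R[i]^o) z 1.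

Definition holomorphic_mx_on p q (U : set R[i]^o)
    (G : R[i] -> 'M[R[i]]_(p, q)) : Prop :=
  forall z, U z -> holomorphic_mx_at G z.

Definition regular_on n (D : set R[i]^o) (T : R[i] -> 'M[R[i]]_n) : Prop :=
  exists2 z0, D z0 & \det (T z0) != 0.

Definition is_eigenvalue n (D : set R[i]^o) (T : R[i] -> 'M[R[i]]_n)
    (lam : R[i]) : Prop :=
  D lam /\ T lam \notin unitmx.

Definition local_smith_form n (T : R[i] -> 'M[R[i]]_n) (lam : R[i])
    (kappa : 'I_n -> nat) : Prop :=
  exists E F : R[i] -> 'M[R[i]]_n,
    [/\ E lam \in unitmx, F lam \in unitmx &
        \forall z \near (lam : R[i]^o),
          [/\ holomorphic_mx_at E z, holomorphic_mx_at F z &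
              T z = E z *m diag_mx (\row_j (z - lam) ^+ kappa j) *m F z]].

(* [m] lists the partial multiplicities in nonincreasing order, with
   repetitions. *)
Definition partial_multiplicities n (T : R[i] -> 'M[R[i]]_n) (lam : R[i])
    (m : seq nat) : Prop :=
  exists2 kappa, local_smith_form T lam kappa &
    m = sort geq [seq k <- codom kappa | (0 < k)%N].

Definition pole_expansion p q s (D : set R[i]^o)
    (G : R[i] -> 'M[R[i]]_(p, q)) (lambda : 'I_s -> R[i]) (mu : 'I_s -> nat)
    (S : 'I_s -> nat -> 'M[R[i]]_(p, q)) : Prop :=
  exists2 H : R[i] -> 'M[R[i]]_(p, q), holomorphic_mx_on D H &
    forall z, D z -> (forall i, z != lambda i) ->
      G z = \sum_(i < s) \sum_(1 <= k < (mu i).+1)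
              (z - lambda i) ^- k *: S i k + H z.

Definition frobenius_norm p q (A : 'M[R[i]]_(p, q)) : R :=
  Num.sqrt (\sum_i \sum_j ComplexField.Normc.normc (A i j) ^+ 2).

(* On column vectors the Frobenius norm is the Euclidean norm. *)
Definition spectral_norm p q (A : 'M[R[i]]_(p, q)) : R :=
  sup [set frobenius_norm (A *m x) |
       x in [set x : 'cV[R[i]]_q | frobenius_norm x <= 1]].

End holomorphic_matrices.

Section gaussian_matrices.
Context {R : realType} (d : measure_display) (W : measurableType d).
Variable P : probability W R.

Definition mutually_independent (I : finType) (X : I -> W -> R) : Prop :=
  forall (J : {set I}) (B : I -> set R), (forall i, measurable (B i)) ->
    (P (\bigcap_(i in [set` J]) X i @^-1` B i)
     = \prod_(i in J) P (X i @^-1` B i))%E.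

Definition sigma_of (I : Type) (X : I -> W -> R) : set (set W) :=
  <<s \bigcup_i preimage_set_system setT (X i) measurable >>.

Definition independent_families (I J : Type) (X : I -> W -> R)
    (Y : J -> W -> R) : Prop :=
  forall A B, sigma_of X A -> sigma_of Y B ->
    (P (A `&` B) = P A * P B)%E.

(* [sigma] is the standard deviation. *)
Definition iid_centered_normal (I : finType) (sigma : R) (X : I -> W -> R) :
    Prop :=
  [/\ forall i, measurable_fun setT (X i),
      mutually_independent X &
      forall i B, measurable B -> P (X i @^-1` B) = normal_prob 0 sigma B].

Definition coordinates n b (Omega : W -> 'M[R[i]]_(n, b))
    (c : ('I_n * 'I_b) * bool) (w : W) : R :=
  let z := Omega w c.1.1 c.1.2 in if c.2 then complex.Im z else complex.Re z.

Definition independent_matrices n b (Omega1 Omega2 : W -> 'M[R[i]]_(n, b)) :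
    Prop :=
  independent_families (coordinates Omega1) (coordinates Omega2).

End gaussian_matrices.

(* The field F: the reals (as a subfield of the complex numbers) or the complex
   numbers. *)
Inductive scalar_field : Set := RealScalars | ComplexScalars.

Definition in_field (R : realType) (F : scalar_field) (z : R[i]) : Prop :=
  if F is RealScalars then complex.Im z = 0 else True.

Definition real_dim (F : scalar_field) : nat :=
  if F is RealScalars then 1%N else 2%N.

(* In the complex case real and imaginary parts have variance 1/2. *)
Definition gaussian_matrix (R : realType) (d : measure_display)
    (W : measurableType d) (P : probability W R) (F : scalar_field) n b
    (Omega : W -> 'M[R[i]]_(n, b)) : Prop :=
  if F is RealScalars then
    (forall w i j, complex.Im (Omega w i j) = 0) /\
    iid_centered_normal P 1 (fun (c : 'I_n * 'I_b) w => complex.Re (Omega w c.1 c.2))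
  else
    iid_centered_normal P (Num.sqrt 2^-1) (coordinates Omega).

(* Main.v *)
(* The Frobenius norm of L^* S M dominates its diagonal entries, and the j-th one,
   u^* S v, only involves the j-th columns u of L and v of M; distinct columns
   being independent, it suffices to bound P(|u^* S v| <= delta) by a multiple of
   delta^l |log delta|.  Choose S p0 q0 <> 0 and write u^* S v = conj(u_p0) a + t
   with a = S p0 q0 v_q0 + t1, where a, t do not involve u_p0 and t1 does not
   involve v_q0.  Conditionally on the other entries, a Gaussian entry charges
   disks of radius r with mass O(r^l).  So |a| <= rho has probability O(rho^l),
   and conditionally on |a| > rho the event |u^* S v| <= delta has probability
   O((delta/rho)^l); on each shell q^k delta < |a| <= q^(k+1) delta the product of
   the two is O(delta^l), and O(|log delta|) shells are enough. *)

Require Import Defs.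
From HB Require Import structures.
From mathcomp Require Import all_boot all_order all_algebra.
From mathcomp Require Import complex.
From mathcomp Require Import ring lra measurable_realfun.
From mathcomp Require Import all_classical all_reals all_analysis.

Set Implicit Arguments.
Unset Strict Implicit.
Unset Printing Implicit Defensive.

Import Order.TTheory GRing.Theory Num.Theory.
Import numFieldNormedType.Exports.

Local Open Scope classical_set_scope.
Local Open Scope ring_scope.
Local Open Scope complex_scope.
Local Open Scope sesquilinear_scope.

(** * Independence *)

Section independence.
Context {R : realType} (d : measure_display) (W : measurableType d).
Variable P : probability W R.

Definition generators (I : finType) (X : I -> W -> R) (J : {set I}) :
    set (set W) :=
  \bigcup_(i in [set` J]) preimage_set_system setT (X i) measurable.

Lemma generators_measurable (I : finType) (X : I -> W -> R) (J : {set I}) :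
  (forall i, measurable_fun setT (X i)) -> <<s generators X J >> `<=` measurable.
Proof.
move=> mX; apply: smallest_sub; first exact: sigma_algebra_measurable.
by move=> A [i _ [B mB <-]]; exact: mX.
Qed.

(** Uniqueness of measures: the finite intersections of preimages form a pi-system [G] generating
    the sigma-algebra of [J], and on [G] the finite measures [P (_]&[X i @^-1] B)[and]P (X i
    @^-1[B) * P _] agree by mutual independence. *)
Lemma mutually_independent_generators (I : finType) (X : I -> W -> R)
    (i : I) (J : {set I}) (B : set R) (A : set W) :
  (forall i, measurable_fun setT (X i)) -> mutually_independent P X ->
  i \notin J -> measurable B -> <<s generators X J >> A ->
  (P (X i @^-1` B `&` A) = P (X i @^-1` B) * P A)%E.
Proof.
move=> mX iX iJ mB.
have mXB j C : measurable C -> measurable (X j @^-1` C).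
  by move=> mC; rewrite -[_ @^-1` _]setTI; exact: mX.
pose G := [set A | exists2 C : I -> set R, forall j, measurable (C j) &
                     A = \bigcap_(j in [set` J]) X j @^-1` C j].
have Gm : G `<=` measurable.
  by move=> _ [C mC ->]; apply: fin_bigcap_measurable => // j _; exact: mXB.
have GT : G setT.
  by exists (fun=> setT) => //; apply/esym; rewrite -subTset => w _ j _.
have GI : setI_closed G.
  move=> _ _ [C mC ->] [C' mC' ->]; exists (fun j => C j `&` C' j).
    by move=> j; exact: measurableI.
  by rewrite -bigcapI.
have sG : <<s generators X J >> `<=` <<s G >>.
  apply: smallest_sub; first exact: smallest_sigma_algebra.
  move=> _ [j Jj [C mC <-]]; apply: sub_sigma_algebra.
  exists (fun k => if k == j then C else setT); first by move=> k; case: ifP.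
  rewrite setTI; apply/seteqP; split => w /=.
    by move=> Cw k _ /=; case: eqP => [->|].
  by move=> /(_ j Jj); rewrite eqxx.
move=> /sG sA; rewrite setIC.
have finP := fin_num_measure P (X i @^-1` B) (mXB _ _ mB).
have p0 : 0 <= fine (P (X i @^-1` B)) by exact: fine_ge0.
rewrite -(fineK finP).
have := @g_sigma_algebra_measure_unique d R W G Gm (fun=> setT) (fun=> GT)
  (bigcup_const _ _) (mrestr P (mXB i B mB))
  (mscale (NngNum p0) P) GI.
apply => //; last first.
  by move=> k /=; rewrite /mrestr setTI ltey_eq finP.
move=> _ [C mC ->].
suff E : (P (\bigcap_(j in [set` J]) X j @^-1` C j `&` X i @^-1` B) =
          (fine (P (X i @^-1` B)))%:E * P (\bigcap_(j in [set` J]) X j @^-1` C j))%E.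
  exact: E.
rewrite fineK// (iX J C)//.
(* The product rule for [i |: J], with [B] placed at the index [i], is compared with the one for [J]
   alone. *)
pose B' j := if j == i then B else C j.
have mB' j : measurable (B' j) by rewrite /B'; case: ifP.
have := iX (i |: J)%SET B' mB'.
rewrite big_setU1//= {2}/B' eqxx.
rewrite (eq_bigr (fun j => P (X j @^-1` C j))); last first.
  by move=> j Jj; rewrite /B'; case: eqP => // ji; rewrite -ji Jj in iJ.
move=> <-; congr (P _); apply/seteqP; split => w /=.
  move=> [Cw Bw] j /=; rewrite !inE => /orP[/eqP->|Jj]; rewrite /B' ?eqxx//.
  by case: eqP => [->|_]//; exact: Cw.
move=> H; split.
  move=> j /= Jj; have := H j; rewrite /= !inE Jj orbT /B' => /(_ isT).
  by case: eqP => // ji; rewrite -ji Jj in iJ.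
by have := H i; rewrite /= !inE eqxx /B' eqxx; exact.
Qed.

(** A finite intersection splits into an [X] part and a [Y] part; independence of the two families
    separates these, and mutual independence factors each of them. *)
Lemma mutually_independent_sum (I : finType) (X Y : I -> W -> R) :
  mutually_independent P X -> mutually_independent P Y ->
  independent_families P X Y ->
  mutually_independent P
    (fun c : I + I => match c with inl i => X i | inr i => Y i end).
Proof.
move=> iX iY iXY J B mB.
pose JX := [set i | inl i \in J]%SET; pose JY := [set i | inr i \in J]%SET.
have sigma_cap Z (K : {set I}) C : (forall i, measurable (C i)) ->
    sigma_of Z (\bigcap_(i in [set` K]) Z i @^-1` C i).
  move=> mC; pose G := \bigcup_i preimage_set_system setT (Z i) measurable.
  apply: (@fin_bigcap_measurable _ (g_sigma_algebraType G)) => // i _.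
  apply: sub_sigma_algebra; exists i => //; exists (C i) => //.
  by rewrite setTI.
transitivity (\prod_(i in JX) P (X i @^-1` (B \o inl) i) *
              \prod_(i in JY) P (Y i @^-1` (B \o inr) i))%E; last first.
  by rewrite big_sumType/=; congr (_ * _)%E; apply: eq_bigl => i; rewrite inE.
rewrite -(iX JX (B \o inl)) => [|i]; last exact: mB.
rewrite -(iY JY (B \o inr)) => [|i]; last exact: mB.
rewrite -iXY; [|by apply: sigma_cap => i; exact: mB..].
congr (P _); apply/seteqP; split => w /=.
  by move=> H; split=> i /=; rewrite inE => iJ; exact: (H _ iJ).
by move=> [HX HY] [i|i] /= iJ; [apply: (HX i)|apply: (HY i)]; rewrite /= inE.
Qed.

End independence.

(** * Small-ball estimates *)

Section small_ball.
Context {R : realType} (d : measure_display) (W : measurableType d).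
Variable P : probability W R.

(** The density never exceeds its peak value. *)
Lemma normal_prob_itv_le (sigma x y : R) : sigma != 0 -> x <= y ->
  (normal_prob 0 sigma `[x, y] <= (normal_peak sigma * (y - x))%:E)%E.
Proof.
move=> s0 xy; rewrite /normal_prob.
apply: (@le_trans _ _ (\int[lebesgue_measure]_(z in `[x, y]) (normal_peak sigma)%:E)%E).
  apply: ge0_le_integral => //=.
  - by move=> z _; rewrite lee_fin normal_pdf_ge0.
  - by apply/measurable_EFinP/measurable_funTS; exact: measurable_normal_pdf.
  - by move=> z _; rewrite lee_fin normal_pdf_ub.
by rewrite integral_cst//= lebesgue_measure_itv/= lte_fin; case: ltP => h;
  rewrite ?mule0 ?lee_fin ?EFinM// mulr_ge0 ?normal_peak_ge0 ?subr_ge0.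
Qed.

Lemma measurable_fun_generators (I : finType) (X : I -> W -> R) (J : {set I})
    (f : W -> R) : (forall i, measurable_fun setT (X i)) ->
  measurable_fun setT (f : g_sigma_algebraType (generators X J) -> R) ->
  measurable_fun setT f.
Proof.
by move=> mX mf _ B mB; apply: (generators_measurable mX); exact: mf.
Qed.

(* Freezing tau up to an error r, on the event floor (tau / r) = m, reduces the
   claim to the independence of X i from events of the other sigma-algebra. *)
Lemma small_ball (I : finType) (X : I -> W -> R) (i : I) (J : {set I})
    (sigma r : R) (tau : W -> R) (B : set W) :
  (forall i, measurable_fun setT (X i)) -> mutually_independent P X ->
  sigma != 0 -> (forall B, measurable B -> P (X i @^-1` B) = normal_prob 0 sigma B) ->
  i \notin J ->
  measurable_fun setT (tau : g_sigma_algebraType (generators X J) -> R) ->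
  <<s generators X J >> B -> 0 < r ->
  (P (B `&` [set w | (`|X i w - tau w| <= r)%R])
     <= (3 * normal_peak sigma * r)%:E * P B)%E.
Proof.
move=> mX iX s0 lawX iJ mtau sB r0.
set E := [set w | _].
have sm := generators_measurable (J := J) mX.
have mE : measurable E.
  rewrite -[E]setTI; apply: measurable_fun_le => //.
  apply: measurableT_comp => //; apply: measurable_funB => //.
  exact: measurable_fun_generators mtau.
(* The cells are naturally indexed by integers; [pickle] renumbers them by naturals, so that series
   apply. Values of [n] outside its range give empty cells. *)
pose A n := [set w | pickle (Num.floor (tau w / r)) = n].
have sA n : <<s generators X J >> (A n).
  have [[m <-]|nm] := pselect (exists m : int, pickle m = n); last first.
    rewrite (_ : A n = set0); first exact: (@measurable0 _ (g_sigma_algebraType _)).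
    by rewrite -subset0 => w Aw; apply: nm; exists (Num.floor (tau w / r)).
  rewrite (_ : A _ = setT `&` tau @^-1` `[m%:~R * r, (m + 1)%:~R * r[).
    by apply: mtau; [exact: (@measurableT _ (g_sigma_algebraType _))|].
  rewrite setTI; apply/seteqP; split => w; rewrite /A/= in_itv/=.
    move=> /(pcan_inj pickleK) <-.
    by rewrite -ler_pdivlMr// -ltr_pdivrMr// floor_itv.
  rewrite -ler_pdivlMr// -ltr_pdivrMr// => /floor_def fw.
  by rewrite fw.
have BE : B = \bigcup_n (A n `&` B).
  apply/seteqP; split => [w Bw|w [n _ []]//].
  by exists (pickle (Num.floor (tau w / r))).
have tA : trivIset setT (fun n => A n `&` B).
  apply/trivIsetP => j k _ _ jk; rewrite -subset0 => w [[Aj _] [Ak _]].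
  by move/eqP: jk; apply; rewrite -Aj -Ak.
have mAB n : measurable (A n `&` B).
  by apply: sm; exact: (@measurableI _ (g_sigma_algebraType _) _ _ (sA n) sB).
have key n : (P (A n `&` B `&` E) <= (3 * normal_peak sigma * r)%:E * P (A n `&` B))%E.
  have [[m mn]|nm] := pselect (exists m : int, pickle m = n); last first.
    rewrite (_ : A n = set0) ?set0I ?measure0 ?mule0//.
    by rewrite -subset0 => w Aw; apply: nm; exists (Num.floor (tau w / r)).
  (* On this cell [tau] stays in an interval of length [r], so [X i] within [r] of [tau] lies in one
     of length [3 * r]: this is the 3 of the bound. *)
  pose K : set R := `[m%:~R * r - r, (m + 1)%:~R * r + r]%classic.
  have -> : 3 * normal_peak sigma * r = normal_peak sigma *
     (((m + 1)%:~R * r + r) - (m%:~R * r - r)).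
    by rewrite intrD; ring.
  apply: (@le_trans _ _ (P (X i @^-1` K `&` (A n `&` B)))).
    have mXK : measurable (X i @^-1` K).
      by rewrite -[_ @^-1` _]setTI; apply: mX => //; exact: measurable_itv.
    apply: le_measure; rewrite ?inE; [exact: measurableI..|].
    move=> w [[Aw Bw] Ew]; split => //; rewrite /K/= in_itv/=.
    have := floor_itv (tau w / r).
    move: Aw; rewrite /A/= -mn => /(pcan_inj pickleK) ->.
    rewrite ler_pdivlMr// ltr_pdivrMr// => /andP[].
    move: Ew; rewrite /E/= ler_norml => /andP[]; set u := (m + 1)%:~R * r.
    set v := _%:~R * r; lra.
  have mK : measurable K by exact: measurable_itv.
  rewrite (mutually_independent_generators mX iX iJ mK); last first.
    exact: (@measurableI _ (g_sigma_algebraType _) _ _ (sA n) sB).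
  rewrite lawX//; apply: lee_wpmul2r => //.
  apply: normal_prob_itv_le => //.
  by rewrite intrD mulrDl mul1r; lra.
(* Countable subadditivity over the cells on the left, additivity over the disjoint pieces of [B] on
   the right. *)
rewrite {1}BE setI_bigcupl.
apply: (@le_trans _ _ (\sum_(n <oo) P (A n `&` B `&` E))%E).
  apply: generalized_Boole_inequality => [n|]; first exact: measurableI.
  by apply: bigcupT_measurable => n; exact: measurableI.
apply: (@le_trans _ _ (\sum_(n <oo) (3 * normal_peak sigma * r)%:E * P (A n `&` B))%E).
  by apply: lee_nneseries => n _ //; exact: key.
rewrite nneseriesZl//.
rewrite [in leRHS]BE measure_bigcup//.
rewrite le_eqVlt; apply/orP; left; apply/eqP; congr (_ * _)%E.
by apply: eq_eseriesl => n; rewrite in_setT.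
Qed.

Lemma measurable_fun_g_sigmaS (G G' : set (set W)) (f : W -> R) :
  <<s G >> `<=` <<s G' >> ->
  measurable_fun setT (f : g_sigma_algebraType G -> R) ->
  measurable_fun setT (f : g_sigma_algebraType G' -> R).
Proof. by move=> GG' mf _ B mB; apply: GG'; exact: mf. Qed.

Lemma generatorsS (I : finType) (X : I -> W -> R) (J J' : {set I}) :
  J \subset J' -> <<s generators X J >> `<=` <<s generators X J' >>.
Proof.
move=> /fintype.subsetP JJ'; apply: sub_sigma_algebra2.
by move=> A [i Ji XA]; exists i => //; exact: JJ'.
Qed.

Lemma measurable_generator (I : finType) (X : I -> W -> R) (J : {set I}) i :
  i \in J -> measurable_fun setT (X i : g_sigma_algebraType (generators X J) -> R).
Proof.
by move=> iJ _ B mB; apply: sub_sigma_algebra; exists i => //; exists B.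
Qed.

End small_ball.

Local Notation normc := ComplexField.Normc.normc.

(** * Measurability of complex-valued functions *)

Section complex_measurable.
Context {R : realType} (d : measure_display) (T : measurableType d).
Implicit Types f g : T -> R[i].

Definition cmeasurable f : Prop :=
  measurable_fun setT (fun t => complex.Re (f t)) /\
  measurable_fun setT (fun t => complex.Im (f t)).

Lemma cmeasurable_cst (z : R[i]) : cmeasurable (fun=> z).
Proof. by split. Qed.

Lemma cmeasurableD f g :
  cmeasurable f -> cmeasurable g -> cmeasurable (fun t => f t + g t).
Proof.
move=> [f1 f2] [g1 g2]; split.
  by under eq_fun do rewrite raddfD; exact: measurable_funD.
by under eq_fun do rewrite raddfD; exact: measurable_funD.
Qed.

Lemma cmeasurableN f : cmeasurable f -> cmeasurable (fun t => - f t).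
Proof.
move=> [f1 f2]; split.
  by under eq_fun do rewrite raddfN; exact: measurable_funN.
by under eq_fun do rewrite raddfN; exact: measurable_funN.
Qed.

Lemma cmeasurableM f g :
  cmeasurable f -> cmeasurable g -> cmeasurable (fun t => f t * g t).
Proof.
move=> [f1 f2] [g1 g2]; split.
  rewrite (_ : (fun t => _) = (fun t => complex.Re (f t) * complex.Re (g t)
             - complex.Im (f t) * complex.Im (g t))).
    by apply: measurable_funB; exact: measurable_funM.
  by apply/funext => t; case: (f t) (g t) => [a b] [a' b'].
rewrite (_ : (fun t => _) = (fun t => complex.Re (f t) * complex.Im (g t)
             + complex.Im (f t) * complex.Re (g t))).
  by apply: measurable_funD; exact: measurable_funM.
by apply/funext => t; case: (f t) (g t) => [a b] [a' b'].
Qed.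

Lemma cmeasurable_conj f : cmeasurable f -> cmeasurable (fun t => (f t)^*).
Proof.
move=> [f1 f2]; split.
  rewrite (_ : (fun t => _) = fun t => complex.Re (f t))//.
  by apply/funext => t; case: (f t).
rewrite (_ : (fun t => _) = fun t => - complex.Im (f t)).
  exact: measurable_funN.
by apply/funext => t; case: (f t).
Qed.

Lemma cmeasurable_sum (I : Type) (s : seq I) (Q : pred I) (F : I -> T -> R[i]) :
  (forall i, Q i -> cmeasurable (F i)) ->
  cmeasurable (fun t => \sum_(i <- s | Q i) F i t).
Proof.
move=> mF; elim: s => [|i s IHs].
  rewrite (_ : (fun t => _) = cst 0); first exact: cmeasurable_cst.
  by apply/funext => t; rewrite big_nil.
under eq_fun => t do rewrite big_cons.
by case: (boolP (Q i)) => // Qi; apply: cmeasurableD => //; exact: mF.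
Qed.

Lemma measurable_normc f : cmeasurable f -> measurable_fun setT (fun t => normc (f t)).
Proof.
move=> [f1 f2].
rewrite (_ : (fun t => _) = Num.sqrt \o
  (fun t => complex.Re (f t) ^+ 2 + complex.Im (f t) ^+ 2)).
  apply: measurableT_comp; last by apply: measurable_funD; exact: measurable_funX.
  by apply: continuous_measurable_fun; exact: sqrt_continuous.
by apply/funext => t /=; case: (f t).
Qed.

Lemma cmeasurableV f : cmeasurable f -> cmeasurable (fun t => (f t)^-1).
Proof.
move=> [f1 f2].
have mN : measurable_fun setT
    (fun t => (complex.Re (f t) ^+ 2 + complex.Im (f t) ^+ 2)^-1).
  (* On nonnegative reals, 0 included, inversion is the power of exponent -1; hence [f] may
     vanish. *)
  under eq_fun do rewrite -powR_inv1 ?addr_ge0 ?sqr_ge0//.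
  apply: (measurableT_comp (measurable_powR (-1))).
  by apply: measurable_funD; exact: measurable_funX.
split.
  rewrite (_ : (fun t => _) = fun t => complex.Re (f t) *
     (complex.Re (f t) ^+ 2 + complex.Im (f t) ^+ 2)^-1).
    exact: measurable_funM.
  by apply/funext => t; case: (f t).
rewrite (_ : (fun t => _) = fun t => - (complex.Im (f t) *
   (complex.Re (f t) ^+ 2 + complex.Im (f t) ^+ 2)^-1)).
  by apply: measurable_funN; exact: measurable_funM.
by apply/funext => t; case: (f t) => a b //=; rewrite mulNr.
Qed.

End complex_measurable.

(** * Elementary inequalities for the modulus *)

Lemma normc_ge0 (R : realType) (z : R[i]) : 0 <= normc z.
Proof. by case: z => a b /=; exact: sqrtr_ge0. Qed.

Lemma normc_gt0 (R : realType) (z : R[i]) : (0 < normc z) = (z != 0).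
Proof.
rewrite lt_def normc_ge0 andbT; congr negb.
apply/eqP/eqP => [/ComplexField.Normc.eq0_normc//|->].
exact: ComplexField.Normc.normc0.
Qed.

Lemma normc_conj (R : realType) (z : R[i]) : normc z^* = normc z.
Proof. by case: z => a b /=; rewrite sqrrN. Qed.

Lemma normc_sum (R : realType) (I : Type) (s : seq I) (F : I -> R[i]) :
  normc (\sum_(i <- s) F i) <= \sum_(i <- s) normc (F i).
Proof.
elim: s => [|i s IHs]; first by rewrite !big_nil ComplexField.Normc.normc0.
by rewrite !big_cons; apply: le_trans (le_normcD _ _) _; rewrite lerD2l.
Qed.

Lemma normc_ge_Re (R : realType) (z : R[i]) : `|complex.Re z| <= normc z.
Proof.
case: z => a b /=; rewrite -sqrtr_sqr ler_wsqrtr// lerDl sqr_ge0//.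
Qed.

Lemma normc_ge_Im (R : realType) (z : R[i]) : `|complex.Im z| <= normc z.
Proof.
case: z => a b /=; rewrite -sqrtr_sqr ler_wsqrtr// lerDr sqr_ge0//.
Qed.

(** * Anticoncentration of the entries and of bilinear forms in them *)

Section spread.
Context {R : realType} (d : measure_display) (W : measurableType d).
Variable P : probability W R.

Definition re_im (I : finType) (z : I -> W -> R[i]) (c : I * bool) (w : W) : R :=
  if c.2 then complex.Im (z c.1 w) else complex.Re (z c.1 w).

Definition entry_generators (I : finType) (z : I -> W -> R[i]) (J : {set I}) :=
  generators (re_im z) [set c | c.1 \in J]%SET.

(* Conditionally on the entries indexed by J, the law of any other entry charges
   every disk of radius r with mass at most kappa r^l. *)
Definition spread (I : finType) (z : I -> W -> R[i]) (kappa : R) (l : nat) :=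
  forall (c : I) (J : {set I}) (B : set W) (tau : W -> R[i]) (r : R),
    c \notin J -> <<s entry_generators z J >> B ->
    cmeasurable (tau : g_sigma_algebraType (entry_generators z J) -> R[i]) ->
    0 < r ->
    (P (B `&` [set w | (normc (z c w - tau w) <= r)%R])
       <= (kappa * r ^+ l)%:E * P B)%E.

Lemma measurable_normc_le (d' : measure_display) (T : measurableType d')
    (f : T -> R[i]) (r : R) :
  cmeasurable f -> measurable [set t | normc (f t) <= r].
Proof.
move=> mf; rewrite -[X in measurable X]setTI; apply: measurable_fun_le => //.
exact: measurable_normc.
Qed.

Lemma measurable_normc_gt (d' : measure_display) (T : measurableType d')
    (f : T -> R[i]) (r : R) :
  cmeasurable f -> measurable [set t | r < normc (f t)].
Proof.
move=> mf; rewrite (_ : [set t | _] = ~` [set t | normc (f t) <= r]).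
  exact/measurableC/measurable_normc_le.
by apply/seteqP; split => t /=; rewrite ltNge => /negP.
Qed.

(** A disk of radius [r] lies in a square of half-side [r]; the real and imaginary parts each
    contribute one factor [3 * normal_peak sigma * r]. *)
Lemma spread_complex (I : finType) (z : I -> W -> R[i]) (sigma : R) :
  sigma != 0 -> iid_centered_normal P sigma (re_im z) ->
  spread z ((3 * normal_peak sigma) ^+ 2) 2.
Proof.
move=> s0 [mz iz lawz] c J B tau r cJ sB [mtau1 mtau2] r0.
pose K := [set c' : I * bool | c'.1 \in J]%SET.
(* Adjoining the imaginary part of [z c] makes [B]&[E] an admissible conditioning event for the real
   part, so that the two bounds multiply. *)
pose K' := ((c, true) |: K)%SET.
have KK' : <<s generators (re_im z) K >> `<=` <<s generators (re_im z) K' >>.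
  by apply: generatorsS; apply: finset.subsetUr.
have cK : (c, true) \notin K by rewrite inE.
have cK' : (c, false) \notin K'.
  by rewrite !inE/= negb_or cJ andbT; apply/eqP => -[].
pose E := [set w | `|re_im z (c, true) w - complex.Im (tau w)| <= r].
have sE : <<s generators (re_im z) K' >> E.
  pose GT := g_sigma_algebraType (generators (re_im z) K').
  rewrite -[E]setTI.
  apply: (@measurable_fun_le _ GT R setT _ (cst r)) => //.
  apply: measurableT_comp => //; apply: measurable_funB.
    by apply: measurable_generator; rewrite !inE eqxx.
  exact: measurable_fun_g_sigmaS mtau2.
have sBE : <<s generators (re_im z) K' >> (B `&` E).
  exact: (@measurableI _ (g_sigma_algebraType _) _ _ (KK' _ sB) sE).
have sm := generators_measurable (J := K') mz.
have mre : measurable [set w | `|re_im z (c, false) w - complex.Re (tau w)| <= r].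
  rewrite -[X in measurable X]setTI; apply: measurable_fun_le => //.
  apply: measurableT_comp => //; apply: measurable_funB => //.
  exact: measurable_fun_generators mtau1.
apply: (@le_trans _ _ (P (B `&` E `&`
    [set w | (`|re_im z (c, false) w - complex.Re (tau w)| <= r)%R]))).
  apply: le_measure; rewrite ?inE.
  - apply: measurableI; first exact: (sm _ (KK' _ sB)).
    apply: measurable_normc_le; split => /=.
      under eq_fun do rewrite raddfB.
      apply: measurable_funB; first exact: (mz (c, false)).
      exact: measurable_fun_generators mtau1.
    under eq_fun do rewrite raddfB.
    apply: measurable_funB; first exact: (mz (c, true)).
    exact: measurable_fun_generators mtau2.
  - by apply: measurableI => //; exact: sm.
  - move=> w [Bw zw]; split; [split => //|].
      by rewrite /E/= /re_im/= -raddfB; apply: le_trans (normc_ge_Im _) zw.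
    by rewrite /= /re_im/= -raddfB; apply: le_trans (normc_ge_Re _) zw.
apply: le_trans (small_ball mz iz s0 (lawz _) cK' _ sBE r0) _.
  exact: measurable_fun_g_sigmaS mtau1.
rewrite !expr2 mulrACA [in leRHS]EFinM -[leRHS]muleA.
apply: lee_wpmul2l; first by rewrite lee_fin !mulr_ge0 ?normal_peak_ge0// ltW.
exact: (small_ball mz iz s0 (lawz _) cK).
Qed.

(** Imaginary parts are constant, hence generate only [set0] and [setT]: the sigma-algebra of the
    entries reduces to that of their real parts, and the disk condition to an interval condition on
    the real part. *)
Lemma spread_real (I : finType) (z : I -> W -> R[i]) (sigma : R) :
  sigma != 0 -> (forall c w, complex.Im (z c w) = 0) ->
  iid_centered_normal P sigma (fun c w => complex.Re (z c w)) ->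
  spread z (3 * normal_peak sigma) 1.
Proof.
move=> s0 z0 [mz iz lawz] c J B tau r cJ sB [mtau1 mtau2] r0.
have GG : <<s entry_generators z J >> `<=`
    <<s generators (fun c w => complex.Re (z c w)) J >>.
  apply: smallest_sub; first exact: smallest_sigma_algebra.
  move=> A [[e []]]; rewrite /= inE /= => eJ [C mC <-]; last first.
    by apply: sub_sigma_algebra; exists e => //; exists C.
  rewrite (_ : re_im z (e, true) = cst 0); last first.
    by apply/funext => w; rewrite /re_im /= z0.
  rewrite preimage_cst setTI; case: ifP => _.
    exact: (@measurableT _ (g_sigma_algebraType _)).
  exact: (@measurable0 _ (g_sigma_algebraType _)).
apply: (@le_trans _ _ (P (B `&`
    [set w | (`|complex.Re (z c w) - complex.Re (tau w)| <= r)%R]))).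
  have sm := generators_measurable (J := J) mz.
  have mB : measurable B by exact: (sm _ (GG _ sB)).
  have mRe : measurable_fun setT (fun w => complex.Re (tau w)).
    apply: (measurable_fun_generators mz (J := J)).
    exact: measurable_fun_g_sigmaS mtau1.
  have mIm : measurable_fun setT (fun w => complex.Im (tau w)).
    apply: (measurable_fun_generators mz (J := J)).
    exact: measurable_fun_g_sigmaS mtau2.
  apply: le_measure; rewrite ?inE.
  - apply: measurableI => //; apply: measurable_normc_le; split => /=.
      by under eq_fun do rewrite raddfB; exact: (measurable_funB (mz c) mRe).
    under eq_fun do rewrite raddfB /= z0.
    exact: measurable_funB.
  - apply: measurableI => //.
    rewrite -[X in measurable X]setTI; apply: measurable_fun_le => //.
    by apply: measurableT_comp => //; exact: (measurable_funB (mz c) mRe).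
  - move=> w [Bw zw]; split => //=.
    by rewrite -raddfB; apply: le_trans (normc_ge_Re _) zw.
rewrite expr1; apply: (small_ball mz iz s0 (lawz c) cJ _ (GG _ sB) r0).
exact: measurable_fun_g_sigmaS mtau1.
Qed.

Lemma cmeasurable_g_sigmaS (G G' : set (set W)) (f : W -> R[i]) :
  <<s G >> `<=` <<s G' >> ->
  cmeasurable (f : g_sigma_algebraType G -> R[i]) ->
  cmeasurable (f : g_sigma_algebraType G' -> R[i]).
Proof.
by move=> GG' [f1 f2]; split; [exact: measurable_fun_g_sigmaS f1|
  exact: measurable_fun_g_sigmaS f2].
Qed.

Lemma cmeasurable_entry (I : finType) (z : I -> W -> R[i]) (J : {set I}) (c : I) :
  c \in J ->
  cmeasurable (z c : g_sigma_algebraType (entry_generators z J) -> R[i]).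
Proof.
move=> cJ; have cbJ b : (c, b) \in [set c' : I * bool | c'.1 \in J]%SET by rewrite inE.
split; first exact: (measurable_generator (X := re_im z) (cbJ false)).
exact: (measurable_generator (X := re_im z) (cbJ true)).
Qed.

Section bilinear.
Context (I : finType) (z : I -> W -> R[i]) (kappa : R) (l : nat).
Hypothesis mz : forall c, measurable_fun setT (re_im z c).
Hypothesis kappa0 : 0 <= kappa.
Hypothesis spread_z : spread z kappa l.

Lemma cmeasurable_entry_generators (J : {set I}) (f : W -> R[i]) :
  cmeasurable (f : g_sigma_algebraType (entry_generators z J) -> R[i]) ->
  cmeasurable f.
Proof.
by move=> [f1 f2]; split; [exact: (measurable_fun_generators mz f1)|
  exact: (measurable_fun_generators mz f2)].
Qed.

(** Factoring out [s] leaves a disk of radius [r / normc s] for [z c], centred at [- (s^-1 * t)]. *)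
Lemma small_ball_affine (c : I) (J : {set I}) (s : R[i]) (t : W -> R[i])
    (B : set W) (r : R) :
  c \notin J -> s != 0 -> <<s entry_generators z J >> B ->
  cmeasurable (t : g_sigma_algebraType (entry_generators z J) -> R[i]) ->
  0 < r ->
  (P (B `&` [set w | (normc (s * z c w + t w) <= r)%R])
     <= (kappa * (r / normc s) ^+ l)%:E * P B)%E.
Proof.
move=> cJ s0 sB mt r0; have ns0 : 0 < normc s by rewrite normc_gt0.
pose tau w := - (s^-1 * t w).
have mtau : cmeasurable (tau : g_sigma_algebraType (entry_generators z J) -> R[i]).
  by apply: cmeasurableN; apply: cmeasurableM => //; exact: cmeasurable_cst.
rewrite (_ : [set w | _] = [set w | normc (z c w - tau w) <= r / normc s]).
  exact: (spread_z cJ sB mtau (divr_gt0 r0 ns0)).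
apply/funext => w /=; congr is_true.
have -> : s * z c w + t w = s * (z c w - tau w).
  by rewrite /tau opprK mulrDr mulVKf.
by rewrite ComplexField.Normc.normcM ler_pdivlMr// mulrC.
Qed.

(** Dividing by [a], of modulus above [r], and conjugating puts [z c] within [delta / r] of a centre
    that depends only on the entries in [J]. *)
Lemma small_ball_quotient (c : I) (J : {set I}) (a t : W -> R[i])
    (B : set W) (r delta : R) :
  c \notin J -> <<s entry_generators z J >> B ->
  cmeasurable (a : g_sigma_algebraType (entry_generators z J) -> R[i]) ->
  cmeasurable (t : g_sigma_algebraType (entry_generators z J) -> R[i]) ->
  0 < r -> 0 < delta ->
  (P (B `&` [set w | (normc ((z c w)^* * a w + t w) <= delta)%R]
        `&` [set w | (r < normc (a w))%R])
     <= (kappa * (delta / r) ^+ l)%:E * P B)%E.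
Proof.
move=> cJ sB ma mt r0 d0.
have mB : measurable B by exact: (generators_measurable mz sB).
(* Where [a] vanishes the quotient has its default value: the centre is still measurable, and the
   event [r < normc (a w)] avoids such points. *)
have mtau : cmeasurable ((fun w => - (t w / a w)^*) :
    g_sigma_algebraType (entry_generators z J) -> R[i]).
  apply: cmeasurableN; apply: cmeasurable_conj.
  by apply: cmeasurableM => //; exact: cmeasurableV.
have mzc : cmeasurable (z c) by split; [exact: (mz (c, false))|exact: (mz (c, true))].
have maW := cmeasurable_entry_generators ma.
apply: le_trans (spread_z cJ sB mtau (divr_gt0 d0 r0)).
apply: le_measure; rewrite ?inE.
- apply: measurableI.
    apply: measurableI => //; apply: measurable_normc_le.
    apply: cmeasurableD; last exact: cmeasurable_entry_generators mt.
    by apply: cmeasurableM => //; exact: cmeasurable_conj.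
  exact: measurable_normc_gt.
- apply: measurableI => //; apply: measurable_normc_le.
  apply: cmeasurableD => //; apply: cmeasurableN.
  exact: cmeasurable_entry_generators mtau.
- move=> w [[Bw Dw] ra]; split => //=; move: Dw ra => /= Dw ra.
  have na0 : 0 < normc (a w) by exact: lt_trans ra.
  have a0 : a w != 0 by rewrite -normc_gt0.
  rewrite opprK -normc_conj rmorphD/= conjcK ler_pdivlMr//.
  apply: le_trans Dw.
  apply: (@le_trans _ _ (normc ((z c w)^* + t w / a w) * normc (a w))).
    by apply: ler_wpM2l (ltW ra); exact: normc_ge0.
  by rewrite -ComplexField.Normc.normcM mulrDl divfK.
Qed.

(* On the shell q^k delta < |a| <= q^(k+1) delta the two small-ball bounds multiply
   to a quantity independent of k, whence the factor K. *)
Lemma small_ball_bilinear (c0 c1 : I) (J0 J1 : {set I}) (s : R[i])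
    (t0 t1 : W -> R[i]) (B : set W) (delta q : R) (K : nat) :
  let a := fun w => s * z c1 w + t1 w in
  c0 \notin J0 -> c1 \in J0 -> c1 \notin J1 -> J1 \subset J0 -> s != 0 ->
  <<s entry_generators z J1 >> B ->
  cmeasurable (t0 : g_sigma_algebraType (entry_generators z J0) -> R[i]) ->
  cmeasurable (t1 : g_sigma_algebraType (entry_generators z J1) -> R[i]) ->
  0 < delta -> 0 < q ->
  (P (B `&` [set w | (normc ((z c0 w)^* * a w + t0 w) <= delta)%R])
     <= (kappa * (delta / normc s) ^+ l
         + K%:R * (kappa ^+ 2 * (q * delta / normc s) ^+ l)
         + kappa * (q ^- K) ^+ l)%:E * P B)%E.
Proof.
move=> a cJ0 c1J0 cJ1 JJ s0 sB mt0 mt1 d0 q0.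
have ns0 : 0 < normc s by rewrite normc_gt0.
have GG : <<s entry_generators z J1 >> `<=` <<s entry_generators z J0 >>.
  apply: generatorsS; apply/fintype.subsetP => c; rewrite !inE.
  exact: (fintype.subsetP JJ).
have mB : measurable B by exact: (generators_measurable mz sB).
have ma : cmeasurable (a : g_sigma_algebraType (entry_generators z J0) -> R[i]).
  apply: cmeasurableD; last exact: cmeasurable_g_sigmaS mt1.
  by apply: cmeasurableM; [exact: cmeasurable_cst|exact: cmeasurable_entry].
have maW := cmeasurable_entry_generators ma.
have mzc : cmeasurable (z c0).
  by split; [exact: (mz (c0, false))|exact: (mz (c0, true))].
set D := [set w | _].
have mD : measurable D.
  apply: measurable_normc_le; apply: cmeasurableD.
    by apply: cmeasurableM => //; exact: cmeasurable_conj.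
  exact: cmeasurable_entry_generators mt0.
pose A r := [set w | normc (a w) <= r].
have mA r : measurable (A r) by exact: measurable_normc_le.
pose C r := [set w | r < normc (a w)].
have mC r : measurable (C r) by exact: measurable_normc_gt.
have sA r : <<s entry_generators z J0 >> (A r).
  exact: (@measurable_normc_le _ (g_sigma_algebraType _)).
have split_shell r X : X `<=` (X `&` A r) `|` (X `&` C r).
  by move=> w Xw; case: (leP (normc (a w)) r) => ar; [left|right].
have [p Pp] : exists p : R, P B = p%:E.
  by exists (fine (P B)); rewrite fineK// fin_num_measure.
have PA r : 0 < r -> (P (B `&` A r) <= (kappa * (r / normc s) ^+ l * p)%:E)%E.
  by move=> r0; rewrite EFinM -Pp; exact: (small_ball_affine cJ1).
pose rho k := q ^+ k * delta.
have rho0 k : 0 < rho k by rewrite mulr_gt0// exprn_gt0.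
have inner k : (P (B `&` D `&` A (rho k)) <=
   ((kappa * (delta / normc s) ^+ l
         + k%:R * (kappa ^+ 2 * (q * delta / normc s) ^+ l)) * p)%:E)%E.
  (* The base is the ball of radius [rho 0 = delta], where the event [D] is dropped; each step adds
     one shell. *)
  elim: k => [|k IHk].
    rewrite /rho expr0 mul1r mul0r addr0; apply: le_trans (PA _ d0).
    apply: le_measure; rewrite ?inE; [by do ?apply: measurableI..|].
    by move=> w [[]].
  apply: (@le_trans _ _ (P ((B `&` D `&` A (rho k)) `|`
       (B `&` A (rho k.+1) `&` D `&` C (rho k))))).
    apply: le_measure; rewrite ?inE.
    - by do ?apply: measurableI.
    - by apply: measurableU; do ?apply: measurableI.
    - move=> w [[Bw Dw] Aw]; case: (leP (normc (a w)) (rho k)) => h.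
        by left.
      by right.
  apply: le_trans (measureU2 _ _ _) _.
    by do ?apply: measurableI.
    by do ?apply: measurableI.
  apply: le_trans (leeD IHk _) _.
    (* As [c1] is in [J0], the bound on [a] can enter the conditioning event, so the estimate for
       [z c0] multiplies the one for [a]. *)
    have sBA : <<s entry_generators z J0 >> (B `&` A (rho k.+1)).
      exact: (@measurableI _ (g_sigma_algebraType _) _ _ (GG _ sB) (sA _)).
    apply: le_trans (small_ball_quotient cJ0 sBA ma mt0 (rho0 k) d0) _.
    apply: lee_wpmul2l (PA _ (rho0 k.+1)).
    by rewrite lee_fin mulr_ge0// exprn_ge0// ltW// divr_gt0.
  rewrite -EFinM -EFinD lee_fin le_eqVlt; apply/orP; left; apply/eqP.
  have -> : delta / rho k = q ^- k.
    by rewrite /rho invfM mulrCA mulfV ?mulr1 ?gt_eqF.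
  have -> : rho k.+1 / normc s = q ^+ k * (q * delta / normc s).
    by rewrite /rho exprSr !mulrA.
  have Q : (q ^- k) ^+ l * (q ^+ k * (q * delta / normc s)) ^+ l =
     (q * delta / normc s) ^+ l.
    by rewrite -exprMn mulKf// gt_eqF// exprn_gt0.
  rewrite -Q -natr1; ring.
(* Beyond the last shell the quotient bound with [r = rho K] suffices by itself and yields the term
   in [q ^- K]. *)
apply: (@le_trans _ _ (P ((B `&` D `&` A (rho K)) `|`
     (B `&` D `&` C (rho K))))).
  apply: le_measure; rewrite ?inE; [exact: measurableI| |exact: split_shell].
  by apply: measurableU; do ?apply: measurableI.
apply: le_trans (measureU2 _ _ _) _.
  by do ?apply: measurableI.
  by do ?apply: measurableI.
apply: le_trans (leeD (inner K)
  (small_ball_quotient cJ0 (GG _ sB) ma mt0 (rho0 K) d0)) _.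
rewrite Pp -!EFinM -EFinD -mulrDl.
have -> : delta / rho K = q ^- K.
  by rewrite /rho invfM mulrCA mulfV ?mulr1 ?gt_eqF.
by [].
Qed.

End bilinear.

(** * Small values of the Frobenius norm of a sandwiched matrix *)

Definition stacked_entries (n b : nat) (OL OR : W -> 'M[R[i]]_(n, b))
    (c : 'I_n * 'I_b + 'I_n * 'I_b) (w : W) : R[i] :=
  match c with inl i => OL w i.1 i.2 | inr i => OR w i.1 i.2 end.

Lemma sandwich_entryE (n b : nat) (L M : 'M[R[i]]_(n, b)) (S : 'M[R[i]]_n) i j :
  (L^t* *m S *m M) i j = \sum_p (L p i)^* * \sum_q S p q * M q j.
Proof.
rewrite -mulmxA !mxE; apply: eq_bigr => p _; rewrite !mxE.
by congr (_ * _).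
Qed.

Lemma cmeasurable_sandwich (d' : measure_display) (T : measurableType d')
    (n b : nat) (L M : T -> 'M[R[i]]_(n, b)) (S : 'M[R[i]]_n) i j :
  (forall p, cmeasurable (fun t => L t p i)) ->
  (forall p, cmeasurable (fun t => M t p j)) ->
  cmeasurable (fun t => ((L t)^t* *m S *m M t) i j).
Proof.
move=> mL mM; under eq_fun do rewrite sandwich_entryE.
apply: cmeasurable_sum => p _; apply: cmeasurableM; first exact: cmeasurable_conj.
apply: cmeasurable_sum => q _; apply: cmeasurableM => //; exact: cmeasurable_cst.
Qed.

Lemma measurable_frobenius_norm (p q : nat) (A : W -> 'M[R[i]]_(p, q)) :
  (forall i j, cmeasurable (fun w => A w i j)) ->
  measurable_fun setT (fun w => frobenius_norm (A w)).
Proof.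
move=> mA; rewrite (_ : (fun w => _) =
  Num.sqrt \o (fun w => \sum_i \sum_j normc (A w i j) ^+ 2))//.
apply: measurableT_comp.
  by apply: continuous_measurable_fun; exact: sqrt_continuous.
apply: measurable_sum => i; apply: measurable_sum => j.
by apply: measurable_funX; exact: measurable_normc.
Qed.

Lemma normc_le_frobenius_norm (p q : nat) (A : 'M[R[i]]_(p, q)) i j :
  normc (A i j) <= frobenius_norm A.
Proof.
rewrite -[leLHS]ger0_norm ?normc_ge0// -sqrtr_sqr ler_wsqrtr//.
rewrite (bigD1 i)//= (bigD1 j)//= -addrA lerDl addr_ge0//.
  by apply: sumr_ge0 => k _; exact: sqr_ge0.
by apply: sumr_ge0 => k _; apply: sumr_ge0 => h _; exact: sqr_ge0.
Qed.

(** Induction on the number of diagonal entries required to be small: those already treated involve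
    other columns only, so they form a conditioning event for the next one, which costs a factor
    [x]. *)
Lemma small_ball_sandwich (n b : nat) (OL OR : W -> 'M[R[i]]_(n, b))
    (kappa : R) (l : nat) (S : 'M[R[i]]_n) (p0 q0 : 'I_n) (delta q : R) (K : nat) :
  (forall c, measurable_fun setT (re_im (stacked_entries OL OR) c)) ->
  0 <= kappa -> spread (stacked_entries OL OR) kappa l ->
  S p0 q0 != 0 -> 0 < delta -> 0 < q ->
  (P [set w | (frobenius_norm ((OL w)^t* *m S *m OR w) <= delta)%R]
     <= ((kappa * (delta / normc (S p0 q0)) ^+ l
         + K%:R * (kappa ^+ 2 * (q * delta / normc (S p0 q0)) ^+ l)
         + kappa * (q ^- K) ^+ l) ^+ b)%:E)%E.
Proof.
set z := stacked_entries OL OR => mz kappa0 sz S0 d0 q0'.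
set x := (kappa * _ + _ + _).
have x0 : 0 <= x.
  have ns0 : 0 <= normc (S p0 q0) by rewrite ltW// normc_gt0.
  by rewrite !addr_ge0 ?mulr_ge0 ?exprn_ge0 ?divr_ge0 ?mulr_ge0 ?invr_ge0
    ?exprn_ge0// ltW.
pose D j w := ((OL w)^t* *m S *m OR w) j j.
pose F k := [set w | forall j : 'I_b, (j < k)%N -> normc (D j w) <= delta].
have mD (J : {set 'I_n * 'I_b + 'I_n * 'I_b}) j :
    (forall p, inl (p, j) \in J) -> (forall p, inr (p, j) \in J) ->
    cmeasurable (D j : g_sigma_algebraType (entry_generators z J) -> R[i]).
  by move=> JL JR; apply: cmeasurable_sandwich => p;
    [exact: (cmeasurable_entry z (JL p))|exact: (cmeasurable_entry z (JR p))].
have sF k (J : {set 'I_n * 'I_b + 'I_n * 'I_b}) :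
    (forall j : 'I_b, (j < k)%N ->
       forall p, (inl (p, j) \in J) && (inr (p, j) \in J)) ->
    <<s entry_generators z J >> (F k).
  move=> kJ; rewrite (_ : F k = \bigcap_(j in [set j : 'I_b | (j < k)%N])
    [set w | normc (D j w) <= delta]); last by [].
  apply: (@fin_bigcap_measurable _ (g_sigma_algebraType _)) => // j jk.
  apply: (@measurable_normc_le _ (g_sigma_algebraType _)); apply: mD => p.
    by have /andP[] := kJ j jk p.
  by have /andP[] := kJ j jk p.
have mF k : measurable (F k).
  apply: (generators_measurable mz).
  by apply: (sF k [set: 'I_n * 'I_b + 'I_n * 'I_b]%SET) => j _ p; rewrite !finset.inE.
have PF k : (k <= b)%N -> (P (F k) <= (x ^+ k)%:E)%E.
  elim: k => [_|k IHk kb]; first by rewrite expr0 probability_le1.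
  pose j := Ordinal kb.
  pose c0 : 'I_n * 'I_b + 'I_n * 'I_b := inl (p0, j).
  pose c1 : 'I_n * 'I_b + 'I_n * 'I_b := inr (q0, j).
  (* Both sets contain every other column and the rest of column [j]. The remainder [t0] may involve
     [c1] but not [c0], while [t1] involves neither. *)
  pose J0 := (~: [set c0])%SET; pose J1 := (~: [set c0; c1])%SET.
  pose t1 w := \sum_(q | q != q0) S p0 q * z (inr (q, j)) w.
  pose t0 w := \sum_(p | p != p0)
    (z (inl (p, j)) w)^* * \sum_q S p q * z (inr (q, j)) w.
  have FE : F k.+1 = F k `&` [set w | normc
      ((z c0 w)^* * (S p0 q0 * z c1 w + t1 w) + t0 w) <= delta].
    have DE w : D j w = (z c0 w)^* * (S p0 q0 * z c1 w + t1 w) + t0 w.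
      by rewrite /D sandwich_entryE (bigD1 p0)//= (bigD1 q0).
    apply/seteqP; split => w /=.
      by move=> Fw; split => [i ik|]; [apply: Fw; exact: ltnW|rewrite -DE; exact: Fw].
    move=> [Fw Dw] i; rewrite ltnS leq_eqVlt => /orP[/eqP ik|]; last exact: Fw.
    by rewrite (_ : i = j) ?DE//; exact: val_inj.
  rewrite FE.
  have sFk : <<s entry_generators z J1 >> (F k).
    apply: sF => i ik p; have ij : i <> j by move=> ij; rewrite ij ltnn in ik.
    have cJ1 c : c != c0 -> c != c1 -> c \in J1.
      by move=> cc0 cc1; rewrite !inE negb_or cc0.
    by rewrite !cJ1//; apply/eqP => -[_ /ij].
  apply: le_trans (small_ball_bilinear mz kappa0 sz (c0 := c0) (c1 := c1) (J0 := J0)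
    (J1 := J1) K _ _ _ _ S0 sFk _ _ d0 q0') _.
  - by rewrite !inE eqxx.
  - by rewrite !inE.
  - by rewrite !inE eqxx orbT.
  - by rewrite finset.setCS finset.sub1set !inE eqxx.
  - apply: cmeasurable_sum => p pp0; apply: cmeasurableM.
      apply: cmeasurable_conj; apply: cmeasurable_entry.
      by rewrite !inE; apply: contra pp0 => /eqP[->].
    apply: cmeasurable_sum => q1 _; apply: cmeasurableM; first exact: cmeasurable_cst.
    by apply: cmeasurable_entry; rewrite !inE.
  - apply: cmeasurable_sum => p pp0; apply: cmeasurableM; first exact: cmeasurable_cst.
    apply: cmeasurable_entry; rewrite !inE negb_or /=.
    by apply: contra pp0 => /eqP[->].
  - rewrite -/x; have -> : (x ^+ k.+1)%:E = (x%:E * (x ^+ k)%:E)%E by rewrite exprS.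
    by apply: lee_wpmul2l; [rewrite lee_fin|apply: IHk; exact: ltnW].
apply: le_trans (PF b (leqnn b)); apply: le_measure; rewrite ?inE//.
  rewrite -[X in measurable X]setTI; apply: measurable_fun_le => //.
  apply: measurable_frobenius_norm => i j; apply: cmeasurable_sandwich => p.
    by split; [exact: (mz (inl (p, i), false))|exact: (mz (inl (p, i), true))].
  by split; [exact: (mz (inr (p, j), false))|exact: (mz (inr (p, j), true))].
move=> w /= Fw j _; apply: le_trans Fw; exact: normc_le_frobenius_norm.
Qed.

End spread.

(** * Tails near zero *)

Section spectral_norm.
Context {R : realType}.

(** The [j]-th basis vector is sent to the [j]-th column, whose norm is at least the modulus of the
    given entry. *)
Lemma spectral_norm_gt0 p q (A : 'M[R[i]]_(p, q)) i j :
  A i j != 0 -> 0 < spectral_norm A.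
Proof.
move=> Aij; have : 0 < normc (A i j) by rewrite normc_gt0.
move/lt_le_trans; apply; apply: (@le_trans _ _ (frobenius_norm (col j A))).
  by have := normc_le_frobenius_norm (col j A) i ord0; rewrite mxE.
apply: ub_le_sup.
  (* The supremum dominates its elements only if the set is bounded above: coordinates of [x] have
     modulus at most 1, so each entry of [A *m x] is at most a row sum of moduli. *)
  exists (Num.sqrt (\sum_i \sum_(k < 1) (\sum_j normc (A i j)) ^+ 2)) => _ [x /= x1 <-].
  apply: ler_wsqrtr; apply: ler_sum => h _; apply: ler_sum => k _.
  rewrite ler_sqr ?nnegrE ?normc_ge0 ?sumr_ge0// => [|? _]; last exact: normc_ge0.
  rewrite mxE; apply: le_trans (normc_sum _ _) _; apply: ler_sum => e _.
  rewrite ComplexField.Normc.normcM ler_piMr ?normc_ge0//.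
  exact: le_trans (normc_le_frobenius_norm _ _ _) x1.
exists (delta_mx j 0); last by rewrite -colE.
rewrite /= /frobenius_norm; under eq_bigr do rewrite big_ord1 mxE eqxx andbT.
rewrite (bigD1 j)//= big1 => [|h hj].
  by rewrite eqxx ComplexField.Normc.normc1 expr1n addr0 sqrtr1.
by rewrite (negPf hj) ComplexField.Normc.normc0 expr0n.
Qed.

End spectral_norm.

Section tails.
Context {R : realType} (d : measure_display) (W : measurableType d).
Variable P : probability W R.

(** The range of [eps] is fixed, so that bounds for several functions combine; measurability is
    carried along for the union bound, and the value [+oo] accommodates empty minima. *)
Definition small_tail (X : R -> R) (g : W -> \bar R) : Prop :=
  exists2 c : R, 0 <= c & forall eps, 0 < eps <= expR (-1) ->
    measurable [set w | (g w <= eps%:E)%E] /\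
    (P [set w | (g w <= eps%:E)%E] <= (c * X eps)%:E)%E.

Lemma small_tail_pinfty X : small_tail X (fun=> +oo%E).
Proof.
exists 0 => // eps _; rewrite (_ : [set w | _] = set0).
  by rewrite measure0 mul0r; split.
by rewrite -subset0 => w /=; rewrite leye_eq.
Qed.

(** Union bound: the constants add up. *)
Lemma small_tail_min X (f g : W -> \bar R) :
  small_tail X f -> small_tail X g -> small_tail X (fun w => Order.min (f w) (g w)).
Proof.
move=> [c c0 fP] [c' c'0 gP]; exists (c + c'); first exact: addr_ge0.
move=> eps e0; have [mf Pf] := fP _ e0; have [mg Pg] := gP _ e0.
rewrite (_ : [set w | _] = [set w | (f w <= eps%:E)%E] `|` [set w | (g w <= eps%:E)%E]).
  split; first exact: measurableU.
  by rewrite mulrDl EFinD; apply: le_trans (measureU2 _ _ _) _ => //; exact: leeD.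
by apply/seteqP; split => w /=; rewrite ge_min => /orP.
Qed.

Lemma small_tail_bigmin X (I : Type) (s : seq I) (Q : pred I) (g : I -> W -> \bar R) :
  (forall i, Q i -> small_tail X (g i)) ->
  small_tail X (fun w => \big[Order.min/+oo%E]_(i <- s | Q i) g i w).
Proof.
move=> gP; elim: s => [|i s IHs].
  rewrite (_ : (fun w => _) = fun=> +oo%E); first exact: small_tail_pinfty.
  by apply/funext => w; rewrite big_nil.
case: (boolP (Q i)) => Qi.
  rewrite (_ : (fun w => _) = fun w => Order.min (g i w)
    (\big[Order.min/+oo%E]_(i <- s | Q i) g i w)).
    by apply: small_tail_min => //; exact: gP.
  by apply/funext => w; rewrite big_cons Qi.
rewrite (_ : (fun w => _) = fun w => \big[Order.min/+oo%E]_(i <- s | Q i) g i w)//.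
by apply/funext => w; rewrite big_cons (negPf Qi).
Qed.

(* With K ~ |ln eps| shells of ratio e the leftover e^(-K l) is at most eps^l. *)
Lemma shells_bound (kappa x sigma : R) (l : nat) :
  0 <= kappa -> 0 < x -> 0 < sigma ->
  exists2 c : R, 0 <= c & forall eps, 0 < eps <= expR (-1) -> exists K : nat,
    kappa * (eps * sigma / x) ^+ l
      + K%:R * (kappa ^+ 2 * (expR 1 * (eps * sigma) / x) ^+ l)
      + kappa * (expR 1 ^- K) ^+ l
    <= c * (eps ^+ l * `|ln eps|).
Proof.
move=> k0 x0 s0.
have a0 : 0 <= kappa * (sigma / x) ^+ l.
  by rewrite mulr_ge0// exprn_ge0// divr_ge0// ltW.
have b0 : 0 <= kappa ^+ 2 * (expR 1 * sigma / x) ^+ l.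
  by rewrite mulr_ge0 ?sqr_ge0// exprn_ge0// divr_ge0 ?mulr_ge0 ?expR_ge0// ltW.
(* One summand for each term to be bounded; the 2 comes from [K <= 2 * |ln eps|]. *)
exists (kappa * (sigma / x) ^+ l
  + 2 * (kappa ^+ 2 * (expR 1 * sigma / x) ^+ l) + kappa).
  by rewrite !addr_ge0// mulr_ge0.
move=> eps /andP[e0 e1].
(* The range of [eps] is chosen for this: [|ln eps|] is at least 1, so the terms without a logarithm
   are absorbed. *)
have lne : ln eps <= -1 by rewrite -(expRK (-1)) ler_ln ?posrE ?expR_gt0.
have aln : `|ln eps| = - ln eps by rewrite ler0_norm// (le_trans lne).
have L1 : 1 <= `|ln eps| by rewrite aln lerNr.
(* The successor brings [K] above [L], whence [expR 1 ^- K <= eps]; as [1 <= L], it still gives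
   [K <= 2 * L]. *)
set L := `|ln eps|; exists (Num.truncn L).+1.
have L0 : 0 <= L by exact: le_trans L1.
have /andP[tL Lt] := truncn_itv L0.
have K2 : (Num.truncn L).+1%:R <= 2 * L by rewrite -natr1; move: L1; rewrite -/L; lra.
have El0 : 0 <= eps ^+ l by rewrite exprn_ge0// ltW.
have qK : (expR 1 ^- (Num.truncn L).+1) ^+ l <= eps ^+ l :> R.
  apply: lerXn2r; rewrite ?nnegrE ?invr_ge0 ?exprn_ge0 ?expR_ge0 ?(ltW e0)//.
  rewrite -expRM_natl mulr1 -expRN -[leRHS]lnK ?posrE// ler_expR.
  by rewrite lerNl -aln ltW.
rewrite !mulrDl; apply: lerD; first apply: lerD.
- rewrite -[eps * sigma / x]mulrA exprMn.
  rewrite mulrA mulrAC.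
  by rewrite ler_wpM2l// ler_peMr.
- rewrite (_ : expR 1 * (eps * sigma) / x = eps * (expR 1 * sigma / x)); last first.
    by rewrite (mulrCA (expR 1)) !mulrA.
  rewrite exprMn; set y := (_ / x) ^+ l in b0 *.
  rewrite [leLHS](_ : _ = kappa ^+ 2 * y * eps ^+ l * (Num.truncn L).+1%:R);
    last by ring.
  rewrite [leRHS](_ : _ = kappa ^+ 2 * y * eps ^+ l * (2 * L)); last by ring.
  by rewrite ler_wpM2l// mulr_ge0.
- rewrite ler_wpM2l//; apply: le_trans qK _.
  by rewrite ler_peMr.
Qed.

(** The normalisation turns the threshold into [delta = eps * spectral_norm S]; the shells have
    ratio [expR 1], matching the natural logarithm. *)
Lemma small_tail_sandwich (n b : nat) (OL OR : W -> 'M[R[i]]_(n, b))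
    (kappa : R) (l : nat) (S : 'M[R[i]]_n) :
  (forall c, measurable_fun setT (re_im (stacked_entries OL OR) c)) ->
  0 <= kappa -> spread P (stacked_entries OL OR) kappa l -> S != 0 ->
  small_tail (fun eps => (eps ^+ l * `|ln eps|) ^+ b)
    (fun w => (frobenius_norm ((OL w)^t* *m S *m OR w) / spectral_norm S)%:E).
Proof.
move=> mz k0 sz S0.
have [p0 [q0 Spq]] : exists p q, S p q != 0.
  apply: contrapT => H; move/eqP: S0; apply; apply/matrixP => p q; rewrite mxE.
  by apply/eqP/negPn/negP => Spq; apply: H; exists p, q.
have sS := spectral_norm_gt0 Spq.
have nS : 0 < normc (S p0 q0) by rewrite normc_gt0.
have [c c0 cP] := shells_bound l k0 nS sS.
exists (c ^+ b); first exact: exprn_ge0.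
move=> eps e01; have /andP[e0 _] := e01; have [K KP] := cP _ e01.
rewrite (_ : [set w | _] = [set w | frobenius_norm ((OL w)^t* *m S *m OR w)
    <= eps * spectral_norm S]); last first.
  by apply/funext => w /=; rewrite lee_fin ler_pdivrMr.
split.
  rewrite -[X in measurable X]setTI; apply: measurable_fun_le => //.
  apply: measurable_frobenius_norm => i j; apply: cmeasurable_sandwich => p.
    by split; [exact: (mz (inl (p, i), false))|exact: (mz (inl (p, i), true))].
  by split; [exact: (mz (inr (p, j), false))|exact: (mz (inr (p, j), true))].
apply: le_trans (small_ball_sandwich K mz k0 sz Spq (mulr_gt0 e0 sS) (expR_gt0 1)) _.
rewrite lee_fin -exprMn; apply: lerXn2r => //; rewrite nnegrE.
  by rewrite !addr_ge0 ?mulr_ge0 ?exprn_ge0 ?divr_ge0 ?mulr_ge0 ?invr_ge0 ?exprn_ge0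
    ?expR_ge0 ?mulr_ge0// ltW.
by rewrite !mulr_ge0 ?exprn_ge0// ltW.
Qed.

End tails.

(** * Gaussian matrices *)

Section gaussian_spread.
Context {R : realType} (d : measure_display) (W : measurableType d).
Variable P : probability W R.

Lemma iid_centered_normal_sum (I : finType) (sigma : R) (X Y : I -> W -> R) :
  iid_centered_normal P sigma X -> iid_centered_normal P sigma Y ->
  independent_families P X Y ->
  iid_centered_normal P sigma
    (fun c : I + I => match c with inl i => X i | inr i => Y i end).
Proof.
move=> [mX iX lX] [mY iY lY] iXY; split.
- by case.
- exact: mutually_independent_sum.
- by case.
Qed.

(** Independence over [K] is independence over its image under the injection [f]; the left inverse
    [g] transports the test sets to the indices in [I]. *)
Lemma iid_centered_normal_reindex (I J : finType) (sigma : R) (X : I -> W -> R)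
    (f : J -> I) (g : I -> J) :
  cancel f g -> iid_centered_normal P sigma X ->
  iid_centered_normal P sigma (X \o f).
Proof.
move=> fK [mX iX lX]; split=> [j|K B mB|j]; [exact: mX| |exact: lX].
have := iX (f @: K)%SET (B \o g) (fun i => mB (g i)).
rewrite big_imset/=; last by move=> ? ? _ _; exact: (can_inj fK).
under eq_bigr do rewrite fK.
move=> <-; congr (P _); apply/seteqP; split => w /= Hw j /= jK.
  by have /imsetP[k kK ->] := jK; rewrite fK; exact: Hw.
by have := Hw (f j); rewrite fK; apply; exact: imset_f.
Qed.

(** Stacking the two matrices gives one independent family of normal coordinates, so both scalar
    fields reduce to [spread], with the real dimension as exponent. *)
Lemma gaussian_spread (F : scalar_field) (n b : nat)
    (OL OR : W -> 'M[R[i]]_(n, b)) :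
  gaussian_matrix P F OL -> gaussian_matrix P F OR ->
  independent_matrices P OL OR ->
  (forall c, measurable_fun setT (re_im (stacked_entries OL OR) c)) /\
  exists2 kappa, 0 <= kappa & spread P (stacked_entries OL OR) kappa (real_dim F).
Proof.
case: F => /=.
  move=> [ImL GL] [ImR GR] LR.
  (* The real parts generate a sub-sigma-algebra of that of all coordinates, so independence of the
     matrices passes to them. *)
  have Re_coordinates (O : W -> 'M[R[i]]_(n, b)) :
      sigma_of (fun (c : 'I_n * 'I_b) w => complex.Re (O w c.1 c.2)) `<=`
      sigma_of (coordinates O).
    apply: sub_sigma_algebra2 => A [c _ HA].
    by exists (c, false).
  have G := iid_centered_normal_sum GL GR
    (fun A B sA sB => LR A B (Re_coordinates _ _ sA) (Re_coordinates _ _ sB)).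
  have Im0 c w : complex.Im (stacked_entries OL OR c w) = 0.
    by case: c => -[p j]; [exact: ImL|exact: ImR].
  have {}G : iid_centered_normal P 1
      (fun c w => complex.Re (stacked_entries OL OR c w)).
    by congr (iid_centered_normal P _ _): G; apply/funext => -[].
  split.
    move=> [c []]; last by have [mG _ _] := G; exact: mG.
    by rewrite (_ : re_im _ _ = cst 0)//; apply/funext => w; exact: Im0.
  exists (3 * normal_peak 1); first by rewrite mulr_ge0 ?normal_peak_ge0.
  by apply: spread_real => //; exact: oner_neq0.
move=> GL GR LR.
have {}GLR := iid_centered_normal_sum GL GR LR.
(* The choice of real or imaginary part sits inside each summand in [GLR], but outside the sum in
   [re_im]; [f] and [g] exchange the two indexings. *)
pose f (c : ('I_n * 'I_b + 'I_n * 'I_b) * bool) :=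
  match c with (inl i, e) => inl (i, e) | (inr i, e) => inr (i, e) end.
pose g (c : ('I_n * 'I_b) * bool + ('I_n * 'I_b) * bool) :=
  match c with inl (i, e) => (inl i, e) | inr (i, e) => (inr i, e) end.
have fK : cancel f g by case=> -[].
have G := iid_centered_normal_reindex fK GLR.
have {}G : iid_centered_normal P (Num.sqrt 2^-1) (re_im (stacked_entries OL OR)).
  by congr (iid_centered_normal P _ _): G; apply/funext => -[[]].
split; first by have [] := G.
exists ((3 * normal_peak (Num.sqrt 2^-1)) ^+ 2); first exact: sqr_ge0.
by apply: spread_complex G; rewrite gt_eqF// sqrtr_gt0 invr_gt0.
Qed.

End gaussian_spread.

(** * Pole expansion of the sandwiched resolvent, and the probability bound *)

(** Each entry is a linear combination of entries of [H], with coefficients independent of [z]. *)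
Lemma holomorphic_mx_at_sandwich (R : realType) (n b : nat)
    (H : R[i] -> 'M[R[i]]_n) (L M : 'M[R[i]]_(n, b)) (z : R[i]) :
  holomorphic_mx_at H z -> holomorphic_mx_at (fun z => L^t* *m H z *m M) z.
Proof.
move=> hH i j.
rewrite (_ : (fun x => _) = \sum_p \sum_q
    ((L p i)^* * M q j) \*: ((fun x : R[i]^o => H x p q : R[i]^o) : R[i]^o -> R[i]^o)).
  by do 2 (apply: derivable_sum => ?); exact/derivableZ/hH.
apply/funext => x; rewrite sandwich_entryE fct_sumE; apply: eq_bigr => p _.
rewrite fct_sumE mulr_sumr; apply: eq_bigr => q _.
by rewrite mulrCA mulrC.
Qed.

Lemma pole_expansion_sandwich (R : realType) (n b s : nat) (D : set R[i]^o)
    (G : R[i] -> 'M[R[i]]_n) (lambda : 'I_s -> R[i]) (mu : 'I_s -> nat)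
    (S : 'I_s -> nat -> 'M[R[i]]_n) (L M : 'M[R[i]]_(n, b)) :
  pole_expansion D G lambda mu S ->
  pole_expansion D (fun z => L^t* *m G z *m M) lambda mu
    (fun i k => L^t* *m S i k *m M).
Proof.
move=> [H hH GE]; exists (fun z => L^t* *m H z *m M).
  by move=> z Dz; apply: holomorphic_mx_at_sandwich; exact: hH.
move=> z Dz zl; rewrite GE// mulmxDr mulmxDl mulmx_sumr mulmx_suml; congr (_ + _).
apply: eq_bigr => i _; rewrite mulmx_sumr mulmx_suml; apply: eq_bigr => k _.
by rewrite -scalemxAr -scalemxAl.
Qed.

Theorem theorem2p7 (R : realType) (F : scalar_field) (n b s : nat)
    (D U : set R[i]^o) (T : R[i] -> 'M[R[i]]_n)
    (lambda : 'I_s -> R[i]) (m : 'I_s -> seq nat)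
    (S : 'I_s -> nat -> 'M[R[i]]_n)
    (d : measure_display) (W : measurableType d) (P : probability W R)
    (OmegaL OmegaR : W -> 'M[R[i]]_(n, b)) :
  let m1 := fun i => head 0%N (m i) in
  jordan_domain D ->
  open U -> connected U -> closure D `<=` U ->
  holomorphic_mx_on U T ->
  regular_on D T ->
  injective lambda ->
  (forall z, is_eigenvalue D T z <-> exists i, z = lambda i) ->
  (forall i, partial_multiplicities T (lambda i) (m i)) ->
  pole_expansion D (fun z => invmx (T z)) lambda m1 S ->
  (forall i k, (1 <= k <= m1 i)%N -> forall p q, in_field F (S i k p q)) ->
  gaussian_matrix P F OmegaL ->
  gaussian_matrix P F OmegaR ->
  independent_matrices P OmegaL OmegaR ->
  (forall w, pole_expansion D
     (fun z => (OmegaL w)^t* *m invmx (T z) *m OmegaR w) lambda m1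
     (fun i k => (OmegaL w)^t* *m S i k *m OmegaR w)) /\
  exists2 c : R, 0 < c &
    \forall eps \near 0^'+,
      (P [set w | \big[Order.min/+oo]_(i < s)
                  \big[Order.min/+oo]_(1 <= k < (m1 i).+1 | S i k != 0%R)
                    (frobenius_norm ((OmegaL w)^t* *m S i k *m OmegaR w)
                     / spectral_norm (S i k))%:E <= eps%:E]
       <= (c * (eps ^+ real_dim F * `|ln eps|) ^+ b)%:E)%E.
Proof.
move=> m1 _ _ _ _ _ _ _ _ _ SE _ GL GR LR; split.
  by move=> w; exact: pole_expansion_sandwich.
have [mz [kappa k0 sz]] := gaussian_spread GL GR LR.
have [c c0 cP] : small_tail P (fun eps => (eps ^+ real_dim F * `|ln eps|) ^+ b)
  (fun w => \big[Order.min/+oo%E]_(i < s)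
                  \big[Order.min/+oo%E]_(1 <= k < (m1 i).+1 | S i k != 0%R)
                    (frobenius_norm ((OmegaL w)^t* *m S i k *m OmegaR w)
                     / spectral_norm (S i k))%:E).
  apply: small_tail_bigmin => i _; apply: small_tail_bigmin => k Sik.
  exact: small_tail_sandwich sz Sik.
(* [small_tail] only provides [0 <= c]; adding 1 makes the constant positive. *)
exists (c + 1); first exact: ltr_wpDl.
near=> eps.
have e01 : 0 < eps <= expR (-1).
  by apply/andP; split; near: eps; [exact: nbhs_right_gt|exact/nbhs_right_le/expR_gt0].
have [_ Pe] := cP _ e01; apply: le_trans Pe _.
have /andP[e0 _] := e01.
by rewrite lee_fin ler_wpM2r ?exprn_ge0 ?mulr_ge0 ?exprn_ge0 ?lerDl// ltW.
Unshelve. all: by end_near.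
Qed.
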